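(* For $p\in\{102,201\}$, we have $$C_p(x,y)=\frac{1-3x+3x^2-2x^2y-x^3+x^3y}{(1-x)(1-3x+2x^2-2x^2y)}.$$
   Context: A Catalan word of length $n\geq 1$ is a word $w_1\ldots w_n$ over the non-negative integers with $w_1=0$ and $0\leq w_i\leq w_{i-1}+1$ for $2\leq i\leq n$; the empty word is the unique Catalan word of length $0$. A word $w$ contains the pattern $p=p_1\ldots p_k$ if there are indices $i_1<\cdots<i_k$ such that $w_{i_1}\ldots w_{i_k}$ is order-isomorphic to $p$ (for all $a,b$: $w_{i_a}<w_{i_b}$ iff $p_a<p_b$, and $w_{i_a}=w_{i_b}$ iff $p_a=p_b$); otherwise $w$ avoids $p$. $\mathcal{C}_n(p)$ is the set of Catalan words of length $n$ avoiding $p$. A descent of $w$ is an index $i$ with $w_i>w_{i+1}$. $C_p(x,y)=\sum_{n,k\geq 0}c_{n,k}x^ny^k$, where $c_{n,k}$ is the number of words in $\mathcal{C}_n(p)$ with exactly $k$ descents. *)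

(* Defs.v *)
From HB Require Import structures.
From mathcomp Require Import all_boot all_order all_algebra.
From mathcomp Require Import boolp.

Set Implicit Arguments.
Unset Strict Implicit.
Unset Printing Implicit Defensive.

Import GRing.Theory.

Definition is_catalan (w : seq nat) : bool :=
  if w is a :: s then (a == 0) && path (fun u v => v <= u.+1) a s else true.

Definition order_iso_at (w p : seq nat) (f : 'I_(size p) -> 'I_(size w)) : bool :=
  [forall a : 'I_(size p), forall b : 'I_(size p),
     ((nth 0 w (f a) < nth 0 w (f b)) == (nth 0 p a < nth 0 p b)) &&
     ((nth 0 w (f a) == nth 0 w (f b)) == (nth 0 p a == nth 0 p b))].

Definition contains (w p : seq nat) : bool :=
  [exists f : {ffun 'I_(size p) -> 'I_(size w)},
     [forall a : 'I_(size p), forall b : 'I_(size p), (a < b) ==> (f a < f b)]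
     && order_iso_at f].

Definition avoids (w p : seq nat) : bool := ~~ contains w p.

(* Indices are 0-based: i is a descent when both i and i.+1 are positions. *)
Definition descents (w : seq nat) : nat :=
  #|[set i : 'I_(size w).-1 | nth 0 w i.+1 < nth 0 w i]|.

(* The letters of a Catalan word of length n are all smaller than n, so that
   drawing the words from the finite type n.-tuple 'I_n omits none. *)
Lemma is_catalan_bounded (w : seq nat) :
  is_catalan w -> all (fun a => a < size w) w.
Proof.
case: w => // a s /= /andP[/eqP-> pth]; apply/andP; split=> //.
suff H m : path (fun u v => v <= u.+1) m s ->
           all (fun b => b < (m + size s).+1) s by exact: H 0 pth.
elim: s m {pth} => //= b s IHs m /andP[lebm /IHs /allP H].
apply/andP; split; first by rewrite addnS ltnS (leq_trans lebm) // ltnS leq_addr.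
apply/allP => c /H; rewrite !ltnS => /leq_trans; apply.
by rewrite addnS -addSn leq_add2r.
Qed.

Definition word_of n (t : n.-tuple 'I_n) : seq nat := map val t.

Definition catalan_avoiding (p : seq nat) (n : nat) : {set n.-tuple 'I_n} :=
  [set t : n.-tuple 'I_n | is_catalan (word_of t) & avoids (word_of t) p].

Definition catalan_desc_num (p : seq nat) (n k : nat) : nat :=
  #|[set t in catalan_avoiding p n | descents (word_of t) == k]|.

Local Open Scope ring_scope.

(* Formal power series in one variable; a record, so that the Cauchy product
   does not clash with the pointwise ring structure on functions. *)
Record fps (R : Type) := Fps { coef_fps : nat -> R }.

Section FpsRing.
Variable R : comNzRingType.
Implicit Types f g h : fps R.

Lemma fpsP f g : coef_fps f =1 coef_fps g -> f = g.
Proof. by case: f g => f [g] /= /funext ->. Qed.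

HB.instance Definition _ := gen_eqMixin (fps R).
HB.instance Definition _ := gen_choiceMixin (fps R).

Definition zero_fps : fps R := Fps (fun=> 0).
Definition opp_fps f := Fps (fun n => - coef_fps f n).
Definition add_fps f g := Fps (fun n => coef_fps f n + coef_fps g n).
Definition const_fps (c : R) : fps R := Fps (fun n => if n == 0%N then c else 0).
Definition one_fps : fps R := const_fps 1.
Definition mul_fps f g :=
  Fps (fun n => \sum_(i < n.+1) coef_fps f i * coef_fps g (n - i)).

Lemma add_fpsA : associative add_fps.
Proof. by move=> f g h; apply: fpsP => n /=; rewrite addrA. Qed.
Lemma add_fpsC : commutative add_fps.
Proof. by move=> f g; apply: fpsP => n /=; rewrite addrC. Qed.
Lemma add_0fps : left_id zero_fps add_fps.
Proof. by move=> f; apply: fpsP => n /=; rewrite add0r. Qed.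
Lemma add_Nfps : left_inverse zero_fps opp_fps add_fps.
Proof. by move=> f; apply: fpsP => n /=; rewrite addNr. Qed.

HB.instance Definition _ :=
  GRing.isZmodule.Build (fps R) add_fpsA add_fpsC add_0fps add_Nfps.

Let trunc m f : {poly R} := \poly_(i < m.+1) coef_fps f i.

Let coef_mul_trunc m f g n : (n <= m)%N ->
  coef_fps (mul_fps f g) n = (trunc m f * trunc m g)`_n.
Proof.
move=> le_nm; rewrite coefM /=; apply: eq_bigr => i _; rewrite !coef_poly !ltnS.
by rewrite (leq_trans _ le_nm) ?leq_ord // (leq_trans (leq_subr _ _) le_nm).
Qed.

Lemma mul_fpsA : associative mul_fps.
Proof.
move=> f g h; apply: fpsP => n.
transitivity ((trunc n f * (trunc n g * trunc n h))`_n).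
  rewrite coefM /=; apply: eq_bigr => i _.
  rewrite coef_poly ltnS leq_ord; congr (_ * _).
  by rewrite -coef_mul_trunc // leq_subr.
rewrite mulrA coefM /=; apply: eq_bigr => i _.
rewrite -coef_mul_trunc ?leq_ord //; congr (_ * _).
by rewrite coef_poly ltnS leq_subr.
Qed.

Lemma mul_fpsC : commutative mul_fps.
Proof.
by move=> f g; apply: fpsP => n; rewrite !(@coef_mul_trunc n) // mulrC.
Qed.

Lemma mul_1fps : left_id one_fps mul_fps.
Proof.
move=> f; apply: fpsP => n /=; rewrite big_ord_recl /= mul1r subn0 big1 ?addr0//.
by move=> i _; rewrite /= mul0r.
Qed.

Lemma mul_fpsDl : left_distributive mul_fps add_fps.
Proof.
move=> f g h; apply: fpsP => n /=; rewrite -big_split /=.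
by apply: eq_bigr => i _; rewrite mulrDl.
Qed.

Lemma one_fps_neq0 : one_fps != 0.
Proof.
by apply/eqP => /(congr1 (fun f => coef_fps f 0)) /= /eqP; rewrite oner_eq0.
Qed.

HB.instance Definition _ :=
  GRing.Zmodule_isComNzRing.Build (fps R)
    mul_fpsA mul_fpsC mul_1fps mul_fpsDl one_fps_neq0.

Definition unit_fps : pred (fps R) := fun f => `[< exists g : fps R, g * f = 1 >].
Definition inv_fps (f : fps R) : fps R :=
  if pselect (exists g : fps R, g * f = 1) is left ex then projT1 (cid ex) else f.

Lemma mul_Vfps : {in unit_fps, left_inverse 1 inv_fps *%R}.
Proof.
by move=> f /asboolP uf; rewrite /inv_fps; case: pselect => // ex; case: cid.
Qed.

Lemma unit_fpsP f g : g * f = 1 -> unit_fps f.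
Proof. by move=> gf; apply/asboolP; exists g. Qed.

Lemma inv_fps_out : {in [predC unit_fps], inv_fps =1 id}.
Proof. by move=> f /asboolPn nuf; rewrite /inv_fps; case: pselect. Qed.

HB.instance Definition _ :=
  GRing.ComNzRing_hasMulInverse.Build (fps R) mul_Vfps unit_fpsP inv_fps_out.

(* In particular the denominators met below, of constant term 1, are units. *)
Lemma unit_fps_coef0 (c : R) f : c * coef_fps f 0 = 1 -> f \is a GRing.unit.
Proof.
move=> cf0; pose nxt (s : seq R) :=
  c * ((size s == 0%N)%:R - \sum_(i < size s) s`_i * coef_fps f (size s - i)).
pose s n := iter n (fun s => rcons s (nxt s)) [::].
have size_s n : size (s n) = n by elim: n => //= n IHn; rewrite size_rcons IHn.
have nth_s m n i : (i < n)%N -> (s (n + m)%N)`_i = (s n)`_i.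
  move=> lt_in; elim: m => [|m IHm]; first by rewrite addn0.
  by rewrite addnS /= nth_rcons size_s ltn_addr.
pose g := Fps (fun n => nxt (s n)).
have coef_g n i : (i < n)%N -> (s n)`_i = coef_fps g i.
  by move=> lt_in; rewrite -(subnKC lt_in) nth_s //= nth_rcons size_s ltnn eqxx.
apply/asboolP; exists g; apply: fpsP => n.
rewrite [LHS]/= big_ord_recr /= subnn {2}/nxt size_s mulrAC cf0 mul1r.
rewrite addrC [X in _ + X](eq_bigr (fun i : 'I_n => (s n)`_i * coef_fps f (n - i))).
  by rewrite subrK; case: eqP.
by move=> i _; rewrite coef_g.
Qed.

Definition var_fps : fps R := Fps (fun n => (n == 1%N)%:R).

End FpsRing.

(* Z[[x,y]], as power series in x with coefficients in Z[[y]]: the coefficient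
   of x^n y^k in f is coef_fps (coef_fps f n) k. *)
Definition fps2 := fps (fps int).
HB.instance Definition _ := GRing.ComUnitRing.on fps2.

Definition xvar : fps2 := var_fps (fps int).
Definition yvar : fps2 := const_fps (var_fps int).

Definition catalan_gf (p : seq nat) : fps2 :=
  Fps (fun n => Fps (fun k => (catalan_desc_num p n k)%:Z)).

(* Main.v *)
(** Read a word from left to right. Whether a letter may follow an avoiding
    prefix depends only on a small state of the prefix (a value and one of two
    or three shapes), so the generating functions of the completions of a
    prefix, one per state, satisfy a linear system indexed by the states. That
    system has a unique solution, which is geometric in the value carried by
    the state: with e = 1 - x, the ratio is 1 + xy / (e^2 - x^2 y) for 102 and
    1 + xy / e for 201. The two solutions differ, but give the same series at
    the initial state. *)

Require Import Defs.
From mathcomp Require Import all_boot all_order all_algebra.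
From mathcomp Require Import ring zify.

Set Implicit Arguments.
Unset Strict Implicit.
Unset Printing Implicit Defensive.

Import GRing.Theory.

(** * Pattern containment through subsequences *)

Lemma subseq_rcons_rcons (T : eqType) (s u : seq T) (x a : T) :
  subseq (rcons s x) (rcons u a) =
  subseq (rcons s x) u || (x == a) && subseq s u.
Proof.
rewrite -subseq_rev !rev_rcons /= -(subseq_rev (rcons s x)) -(subseq_rev s).
rewrite rev_rcons; case: eqP => [_|_] /=; last by rewrite orbF.
by apply/idP/orP => [|[|//]]; [right | apply: subseq_trans (subseq_cons _ _)].
Qed.

Lemma subseq_iota (s : seq nat) n :
  sorted ltn s -> all (fun i => i < n) s -> subseq s (iota 0 n).
Proof.
move=> s_sorted /allP s_lt.
(* A strictly increasing list is determined by its members. *)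
have -> : s = filter (mem s) (iota 0 n); last exact: filter_subseq.
apply: (irr_sorted_eq ltn_trans ltnn s_sorted).
  by rewrite (sorted_filter ltn_trans) // iota_ltn_sorted.
move=> i; rewrite mem_filter mem_iota /= add0n.
by case s_i: (i \in s); rewrite //= s_lt.
Qed.

(** Two letters are equal exactly when neither is smaller, so comparing by [<] over all ordered
    pairs of positions already gives order-isomorphism. *)
Lemma containsP (w p : seq nat) :
  reflect (exists2 s, subseq s w & size s = size p /\
             forall a b, a < size p -> b < size p ->
               (nth 0 s a < nth 0 s b) = (nth 0 p a < nth 0 p b))
          (contains w p).
Proof.
apply: (iffP existsP) => [[f /andP[/forallP f_mono /forallP f_iso]] | ].
  pose t := [seq val (f a) | a <- enum 'I_(size p)].
  have size_t : size t = size p by rewrite size_map size_enum_ord.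
  have nth_t (a : 'I_(size p)) : nth 0 t a = f a.
    by rewrite (nth_map a) ?size_enum_ord // nth_ord_enum.
  exists [seq nth 0 w i | i <- t].
    rewrite -[X in subseq _ X](mkseq_nth 0) map_subseq // subseq_iota //.
      rewrite sorted_map; have: sorted ltn (map val (enum 'I_(size p))).
        by rewrite val_enum_ord iota_ltn_sorted.
      rewrite sorted_map; apply: sub_sorted => a b /= lt_ab.
      by move/forallP/(_ b)/implyP: (f_mono a) => /(_ lt_ab).
    by apply/allP => _ /mapP[a _ ->] /=; apply: ltn_ord.
  rewrite size_map size_t; split=> // a b a_lt b_lt.
  rewrite !(nth_map 0) ?size_t //.
  have /forallP/(_ (Ordinal b_lt)) := f_iso (Ordinal a_lt).
  by rewrite -!nth_t => /andP[/eqP].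
case=> s s_w [size_s s_iso].
have /subseqP[m _ def_s] : subseq s [seq nth 0 w i | i <- iota 0 (size w)].
  by rewrite -/(mkseq _ _) mkseq_nth.
(* The mask that extracts [s] from [w], applied to the positions of [w], lists the values of the
   embedding. *)
pose t := mask m (iota 0 (size w)).
have t_iota : subseq t (iota 0 (size w)) by exact: mask_subseq.
have t_sorted : sorted ltn t.
  exact: subseq_sorted ltn_trans _ _ t_iota (iota_ltn_sorted _ _).
have {}def_s : s = [seq nth 0 w i | i <- t] by rewrite def_s map_mask.
have size_t : size t = size p by rewrite -size_s def_s size_map.
have t_lt (a : 'I_(size p)) : nth 0 t a < size w.
  have: nth 0 t a \in t by rewrite mem_nth // size_t.
  by move/(mem_subseq t_iota); rewrite mem_iota.
exists [ffun a => Ordinal (t_lt a)].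
have nth_s (a : 'I_(size p)) : nth 0 s a = nth 0 w (nth 0 t a).
  by rewrite def_s (nth_map 0) // size_t.
apply/andP; split.
  apply/forallP => a; apply/forallP => b; apply/implyP => lt_ab.
  by rewrite !ffunE /= (sorted_ltn_nth ltn_trans) ?inE ?size_t.
apply/forallP => a; apply/forallP => b; rewrite !ffunE /= -!nth_s.
rewrite s_iso // eqxx /= [_ == nth 0 s b]eqn_leq [_ == nth 0 p b]eqn_leq.
by rewrite !(leqNgt (nth _ _ _)) !s_iso.
Qed.

Lemma avoids_prefix (p u w : seq nat) : avoids (u ++ w) p -> avoids u p.
Proof.
apply: contra => /containsP[s s_u iso]; apply/containsP; exists s => //.
exact: subseq_trans s_u (prefix_subseq _ _).
Qed.

Lemma forall_lt3 (P : nat -> nat -> Prop) :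
  [/\ P 0 0, P 0 1 & P 0 2] -> [/\ P 1 0, P 1 1 & P 1 2] ->
  [/\ P 2 0, P 2 1 & P 2 2] -> forall a b, a < 3 -> b < 3 -> P a b.
Proof.
by move=> [? ? ?] [? ? ?] [? ? ?] [|[|[|//]]] [|[|[|//]]].
Qed.

(* Only meaningful for p = 102 (then p_0 = 1) and p = 201. *)
Definition occurs_as (p : seq nat) (b c d : nat) : bool :=
  if nth 0 p 0 == 1 then c < b < d else c < d < b.

Lemma avoids3P (p w : seq nat) : p \in [:: [:: 1; 0; 2]; [:: 2; 0; 1]] ->
  reflect (forall b c d, subseq [:: b; c; d] w -> ~~ occurs_as p b c d)
          (avoids w p).
Proof.
move=> hp; apply: (iffP negP) => [av b c d sub_w | av /containsP[s s_w]].
  apply/negP => occ; apply: av; apply/containsP; exists [:: b; c; d] => //.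
  move: hp occ; rewrite !inE /occurs_as => /orP[]/eqP-> /= /andP[lt1 lt2];
    by split=> //; apply: forall_lt3; split; move=> /=; lia.
have size_p : size p = 3 by move: hp; rewrite !inE => /orP[]/eqP->.
rewrite size_p; case; case: s s_w => [|b [|c [|d []]]] // s_w _ iso.
move/negP: (av _ _ _ s_w); apply.
move: (iso 1 0 isT isT) (iso 1 2 isT isT) (iso 0 2 isT isT) (iso 2 0 isT isT).
by move: hp; rewrite !inE /occurs_as => /orP[]/eqP-> /=; lia.
Qed.

(** A new occurrence must end in the appended letter, so only the pairs of [u] that could precede it
    have to be checked. *)
Lemma avoids3_rconsP (p u : seq nat) (a : nat) :
  p \in [:: [:: 1; 0; 2]; [:: 2; 0; 1]] -> avoids u p ->
  reflect (forall b c, subseq [:: b; c] u -> ~~ occurs_as p b c a)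
          (avoids (rcons u a) p).
Proof.
move=> hp av_u; apply: (iffP (avoids3P _ hp)) => [av b c bc_u | av b c d].
  by apply: av; rewrite -/(rcons [:: b; c] a) subseq_rcons_rcons eqxx bc_u orbT.
rewrite -/(rcons [:: b; c] d) subseq_rcons_rcons => /orP[|/andP[/eqP->]].
  exact: (avoids3P _ hp av_u).
exact: av.
Qed.

(** * Catalan words as lists, counted by descents *)

(** [b] is the largest first letter allowed, so the words that may follow a letter [c] are found at
    [b = c.+1]. *)
Fixpoint step_words (n b : nat) : seq (seq nat) :=
  if n is n'.+1 then
    [seq a :: w | a <- index_iota 0 b.+1, w <- step_words n' a.+1]
  else [:: [::]].

Fixpoint desc_from (c : nat) (w : seq nat) : nat :=
  if w is a :: w' then (a < c) + desc_from a w' else 0.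

Lemma mem_step_words n c w :
  (w \in step_words n c.+1) =
  (size w == n) && path (fun u v => v <= u.+1) c w.
Proof.
elim: n c w => [|n IHn] c w; first by rewrite inE; case: w.
apply/allpairsPdep/idP => [[a [v [a_c v_n ->]]] | ].
  move: a_c v_n; rewrite mem_index_iota IHn ltnS /= => -> /andP[/eqP-> ->].
  by rewrite eqxx.
case: w => [|a v] //= /andP[]; rewrite eqSS => size_v /andP[a_c path_v].
by exists a, v; rewrite mem_index_iota IHn size_v.
Qed.

Lemma uniq_step_words n b : uniq (step_words n b).
Proof.
elim: n b => [|n IHn] b //.
apply: (@allpairs_uniq_dep nat (fun=> seq nat) _ (fun a w => a :: w)) => //.
  exact: iota_uniq.
by move=> [a v] [a' v'] _ _ /= [-> ->].
Qed.

Lemma descents_cons c w : descents (c :: w) = desc_from c w.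
Proof.
have descents_sum v :
    descents v = \sum_(i < (size v).-1) (nth 0 v i.+1 < nth 0 v i).
  rewrite /descents -sum1_card big_mkcond /=; apply: eq_bigr => i _.
  by rewrite inE; case: (_ < _).
rewrite descents_sum; elim: w c => [|a w IHw] c; first by rewrite big_ord0.
by rewrite /= big_ord_recl /= -IHw.
Qed.

Lemma catalan_desc_num0 p k :
  catalan_desc_num p 0 k = (avoids [::] p && (k == 0)) :> nat.
Proof.
have tupleE (t : 0.-tuple 'I_0) : word_of t = [::] by rewrite tuple0.
have descE : descents [::] = 0 by rewrite /descents; apply: eq_card0; case.
rewrite /catalan_desc_num.
have -> : [set t in catalan_avoiding p 0 | descents (word_of t) == k] =
          [set t : 0.-tuple 'I_0 | avoids [::] p && (k == 0)].
  by apply/setP => t; rewrite !inE tupleE descE /= eq_sym.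
case: (avoids _ _ && _); last by apply: eq_card0 => t; rewrite inE.
by rewrite cardsT card_tuple.
Qed.

Lemma catalan_desc_numS p n k :
  catalan_desc_num p n.+1 k =
  \sum_(w <- step_words n 1 | avoids (0 :: w) p) (desc_from 0 w == k).
Proof.
transitivity (count (fun w => avoids (0 :: w) p && (desc_from 0 w == k))
                    (step_words n 1)); last first.
  by rewrite -sum1_count big_mkcondr; apply: eq_bigr => w _; case: (_ == k).
(* Both counts become sizes of duplicate-free lists of words, compared by membership. *)
rewrite -size_filter -(size_map (cons 0)) /catalan_desc_num cardE.
rewrite -(size_map (@word_of n.+1)); apply/perm_size/uniq_perm.
- rewrite map_inj_uniq ?enum_uniq // => s t /(inj_map val_inj).
  exact: val_inj.
- by rewrite map_inj_uniq ?filter_uniq ?uniq_step_words // => s t [].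
move=> w; apply/mapP/mapP => [[t] | [v]].
  rewrite mem_enum !inE => /andP[/andP[cat_t av_t] desc_t] ->.
  have size_t : size (word_of t) = n.+1 by rewrite size_map size_tuple.
  move: (word_of t) cat_t av_t desc_t size_t => [|a v] //=.
  case/andP=> /eqP-> path_v av_v desc_v [size_v]; exists v => //.
  by rewrite mem_filter av_v -descents_cons desc_v mem_step_words size_v eqxx.
rewrite mem_filter mem_step_words => /andP[/andP[av_v desc_v]].
case/andP=> /eqP size_v path_v def_w.
have cat_w : is_catalan w by rewrite def_w.
have size_w : size w = n.+1 by rewrite def_w /= size_v.
have w_lt : all (fun a => a < n.+1) w by rewrite -size_w is_catalan_bounded.
have size_t : size (map (@inord n) w) == n.+1 by rewrite size_map size_w.
have tE : word_of (Tuple size_t) = w.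
  rewrite /word_of /= -map_comp map_id_in // => a /(allP w_lt) /= a_lt.
  by rewrite inordK.
exists (Tuple size_t) => //.
by rewrite mem_enum !inE tE cat_w def_w av_v descents_cons desc_v.
Qed.

Local Open Scope ring_scope.

(** * Coefficients of power series *)

Section FpsCoef.
Variable R : comNzRingType.
Implicit Types f g : fps R.

Lemma coef_fpsD f g n : coef_fps (f + g) n = coef_fps f n + coef_fps g n.
Proof. by []. Qed.

Lemma coef_fps_sum (I : Type) (r : seq I) (P : pred I) (F : I -> fps R) n :
  coef_fps (\sum_(i <- r | P i) F i) n = \sum_(i <- r | P i) coef_fps (F i) n.
Proof. by apply: (big_morph (fun f => coef_fps f n)). Qed.

Lemma coef_fps1 n : coef_fps (1 : fps R) n = (n == 0)%:R.
Proof. by rewrite /=; case: eqP. Qed.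

Lemma coef_const_fpsM c f n : coef_fps (const_fps c * f) n = c * coef_fps f n.
Proof.
by rewrite /= big_ord_recl /= subn0 big1 ?addr0 // => i _; rewrite mul0r.
Qed.

Lemma coef_var_fpsM0 f : coef_fps (var_fps R * f) 0 = 0.
Proof. by rewrite /= big_ord1 mul0r. Qed.

Lemma coef_var_fpsMS f n : coef_fps (var_fps R * f) n.+1 = coef_fps f n.
Proof.
rewrite /= 2!big_ord_recl /= mul0r add0r mul1r /bump /= subSS subn0.
by rewrite big1 ?addr0 // => i _; rewrite mul0r.
Qed.

Lemma coef_var_fpsX d n : coef_fps (var_fps R ^+ d) n = (d == n)%:R.
Proof.
elim: d n => [|d IHd] [|n]; rewrite ?expr0 ?coef_fps1 // exprS.
  by rewrite coef_var_fpsM0.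
by rewrite coef_var_fpsMS IHd.
Qed.

End FpsCoef.

Lemma coef_yvarXM d (f : fps2) n :
  coef_fps (yvar ^+ d * f) n = var_fps int ^+ d * coef_fps f n.
Proof.
elim: d n => [|d IHd] n; first by rewrite !expr0 !mul1r.
by rewrite !exprS -!mulrA coef_const_fpsM IHd.
Qed.

(** * Series of the completions of a prefix *)

(** A descent from the last letter of [u] into [w] is counted, those inside [u] are not: this lets
    the series depend on the state of [u] alone. *)
Definition completion_gf (p u : seq nat) : fps2 :=
  Fps (fun n => \sum_(w <- step_words n (last 0%N u).+1 | avoids (u ++ w) p)
                  var_fps int ^+ desc_from (last 0%N u) w).

(** The term 1 is the empty word; the factor [xvar] is the forced first letter 0. *)
Lemma catalan_gf_completion p : avoids [::] p ->
  catalan_gf p = 1 + xvar * completion_gf p [:: 0%N].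
Proof.
move=> av_nil; apply: fpsP => -[|n]; rewrite coef_fpsD coef_fps1.
  rewrite coef_var_fpsM0 addr0; apply: fpsP => k.
  by rewrite coef_fps1 /= catalan_desc_num0 av_nil; case: k.
rewrite coef_var_fpsMS add0r; apply: fpsP => k.
rewrite /= catalan_desc_numS coef_fps_sum -natz natr_sum.
by apply: eq_bigr => w _; rewrite coef_var_fpsX.
Qed.

(* The equations for [phi] determine its coefficients one by one, as the
   coefficient of x^(n+1) only involves those of x^n. *)
Lemma completion_gf_transfer (p : seq nat) (S : Type) (cur : S -> nat)
    (next : S -> nat -> option S) (inv : S -> seq nat -> Prop)
    (phi : S -> fps2) :
  (forall s u, inv s u -> last 0%N u = cur s /\ avoids u p) ->
  (forall s u a, inv s u -> (a <= (cur s).+1)%N ->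
     if next s a is Some s' then inv s' (rcons u a)
     else ~~ avoids (rcons u a) p) ->
  (forall s, phi s = 1 + xvar * \sum_(0 <= a < (cur s).+2)
                       yvar ^+ (a < cur s)%N * oapp phi 0 (next s a)) ->
  forall s u, inv s u -> completion_gf p u = phi s.
Proof.
move=> inv_cur inv_next phiE s u inv_s; apply: fpsP => n.
elim: n s u inv_s => [|n IHn] s u inv_s; have [u_s av_u] := inv_cur s u inv_s.
  rewrite phiE coef_fpsD coef_var_fpsM0 addr0 /= big_mkcond big_seq1 cats0.
  by rewrite av_u expr0.
rewrite phiE coef_fpsD coef_fps1 add0r coef_var_fpsMS coef_fps_sum.
transitivity (\sum_(0 <= a < (cur s).+2) \sum_(w <- step_words n a.+1)
    if avoids (u ++ a :: w) p
    then var_fps int ^+ ((a < cur s) + desc_from a w) else 0).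
  by rewrite [LHS]big_mkcond u_s [LHS]big_allpairs_dep.
apply: eq_big_nat => a /andP[_ a_le]; rewrite coef_yvarXM.
have := inv_next s u a inv_s a_le.
case: (next s a) => [s' inv_s' | nav] /=.
  rewrite -(IHn _ _ inv_s') /= last_rcons mulr_sumr [RHS]big_mkcond.
  by apply: eq_bigr => w _; rewrite -cat_rcons exprD.
(* Once the prefix contains the pattern, no completion avoids it. *)
rewrite mulr0 big1 // => w _; rewrite -cat_rcons ifN //.
by apply: contra nav; apply: avoids_prefix.
Qed.

Lemma subseq2_rcons (u : seq nat) (a b c : nat) :
  subseq [:: b; c] (rcons u a) =
  subseq [:: b; c] u || (c == a) && (b \in u).
Proof. by rewrite -/(rcons [:: b] c) subseq_rcons_rcons sub1seq. Qed.

(** For states whose descents all lead into one family [down]: the descents become a sum ready for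
    [geometric_sum], apart from the level step and the rise. *)
Lemma sum_next_state (R : nzRingType) (y : R) (S : Type) (phi : S -> R)
    (next : nat -> option S) (down : nat -> S) m :
  (forall a, (a < m)%N -> next a = Some (down a)) ->
  \sum_(0 <= a < m.+2) y ^+ (a < m)%N * oapp phi 0 (next a) =
  \sum_(0 <= a < m) y * phi (down a) +
    oapp phi 0 (next m) + oapp phi 0 (next m.+1).
Proof.
move=> next_lt; rewrite 2?big_nat_recr //= ltnn ltnNge leqnSn /= !mul1r.
do 2![congr (_ + _)]; apply: eq_big_nat => a /andP[_ lt_a].
by rewrite lt_a next_lt.
Qed.

(** Since [z = r - 1], the sum telescopes. This is what makes the solutions geometric: the constant
    1 and the descents together give back a power of [r]. *)
Lemma geometric_sum (R : comNzRingType) (z r : R) m :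
  r = 1 + z -> 1 + \sum_(0 <= a < m) z * r ^+ a = r ^+ m.
Proof.
move=> def_r; elim: m => [|m IHm]; first by rewrite big_geq ?addr0.
by rewrite big_nat_recr //= addrA IHm exprS {3}def_r mulrDl mul1r.
Qed.

(** * The pattern 102 *)

(* [Rise m]: weakly increasing so far, at letter m.  [Fall c e]: the smallest
   letter from the first descent on is c, and the current letter is c + e. *)
Inductive state102 := Rise of nat | Fall of nat & bool.

Definition cur102 s := match s with Rise m => m | Fall c e => (c + e)%N end.

(** In [Fall c _] every drop of the prefix starts above [c] and one starts at [c.+1], so the letters
    that may follow are those up to [c.+1]. *)
Definition next102 s a :=
  match s with
  | Rise m => Some (if (a < m)%N then Fall a false else Rise a)
  | Fall c _ => if (a <= c)%N then Some (Fall a false)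
                else if a == c.+1 then Some (Fall c true) else None
  end.

(** The membership clauses guarantee that when the word falls to [a], an earlier letter [a.+1] is
    there to form the drop [a.+1], [a]. *)
Definition inv102 s (u : seq nat) : Prop :=
  last 0%N u = cur102 s /\
  match s with
  | Rise m => (forall z, (z \in u) = (z <= m)%N) /\
              (forall b c, subseq [:: b; c] u -> (b <= c)%N)
  | Fall m _ => [/\ avoids u [:: 1; 0; 2]%N,
                    forall z, (z <= m.+1)%N -> z \in u,
                    subseq [:: m.+1; m] u &
                    forall b c, subseq [:: b; c] u -> (c < b)%N -> (m < b)%N]
  end.

Lemma inv102_avoids s u : inv102 s u -> avoids u [:: 1; 0; 2]%N.
Proof.
case: s => [m|m e] [_ []] // _ no_drop.
apply/avoids3P => // b c d bcd; rewrite /occurs_as /=.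
have /no_drop : subseq [:: b; c] u.
  by apply: subseq_trans bcd; rewrite -/(rcons [:: b; c] d) subseq_rcons.
lia.
Qed.

Lemma inv102_next s u a : inv102 s u -> (a <= (cur102 s).+1)%N ->
  if next102 s a is Some s' then inv102 s' (rcons u a)
  else ~~ avoids (rcons u a) [:: 1; 0; 2]%N.
Proof.
move=> inv_s; have av_u := inv102_avoids inv_s.
have avE := @avoids3_rconsP [:: 1; 0; 2]%N u a isT av_u.
case: s inv_s => [m|m e] [_] /=.
  case=> mem_u no_drop le_a; case: ltnP => [lt_a | ge_a]; split.
  - by rewrite last_rcons /= addn0.
  - split=> [| z z_le | | b c].
    + by apply/avE => b c /no_drop; rewrite /occurs_as /=; lia.
    + by rewrite mem_rcons inE mem_u; lia.
    + by rewrite subseq2_rcons eqxx mem_u; lia.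
    + by rewrite subseq2_rcons => /orP[/no_drop | /andP[/eqP-> _]]; lia.
  - by rewrite last_rcons.
  split=> [z | b c]; first by rewrite mem_rcons inE mem_u; lia.
  by rewrite subseq2_rcons mem_u => /orP[/no_drop | ]; lia.
case=> _ mem_u drop_u low_u le_a.
have av_a : (a <= m.+1)%N -> avoids (rcons u a) [:: 1; 0; 2]%N.
  by move=> a_le; apply/avE => b c /low_u; rewrite /occurs_as /=; lia.
case: leqP => [a_le | a_gt]; last case: eqP => [def_a | ne_a].
- split; first by rewrite last_rcons /= addn0.
  split=> [| z z_le | | b c]; first by apply: av_a; lia.
  + by rewrite mem_rcons inE mem_u ?orbT //; lia.
  + by rewrite subseq2_rcons eqxx mem_u ?orbT //; lia.
  by rewrite subseq2_rcons => /orP[/low_u | /andP[/eqP->]]; lia.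
- split; first by rewrite last_rcons /= def_a addn1.
  split=> [| z z_le | | b c]; first by apply: av_a; lia.
  + by rewrite mem_rcons inE mem_u ?orbT.
  + by rewrite subseq2_rcons drop_u.
  by rewrite subseq2_rcons => /orP[/low_u // | /andP[/eqP->]]; lia.
(* Here [m.+1], [m], [a] is an occurrence of 102. *)
by apply/avE => /(_ _ _ drop_u); rewrite /occurs_as /=; lia.
Qed.

(** With the descents absorbed into a power of [r], only level steps and rises remain. [Fall c true]
    has just the level step, hence the coefficient [i], the inverse of [1 - x]; [Rise] has both,
    hence [t]. *)
Definition phi102 (R : nzRingType) (l i r t : R) s : R :=
  match s with
  | Rise m => t * r ^+ m
  | Fall c false => l * r ^+ c
  | Fall c true => i * r ^+ c.+1
  end.

Lemma phi102_eq (R : comNzRingType) (x y l i r t : R) :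
    i * (1 - x) = 1 -> l * ((1 - x) ^+ 2 - x ^+ 2 * y) = 1 ->
    r = 1 + x * y * l -> t * (1 - x - x * r) = 1 ->
  forall s, phi102 l i r t s = 1 + x * \sum_(0 <= a < (cur102 s).+2)
              y ^+ (a < cur102 s)%N * oapp (phi102 l i r t) 0 (next102 s a).
Proof.
move=> iE lE def_r tE s.
have geom m : x * (\sum_(0 <= a < m) y * (l * r ^+ a)) = r ^+ m - 1.
  rewrite -(geometric_sum m def_r) mulr_sumr [1 + _]addrC addrK.
  by apply: eq_bigr => a _; rewrite !mulrA.
rewrite (@sum_next_state _ _ _ _ _ (fun a => Fall a false)); last first.
  case: s => [m|c e] a /= lt_a; first by rewrite lt_a.
  by have -> : (a <= c)%N by case: e lt_a; lia.
rewrite /= !mulrDr geom.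
case: s => [m|c []] /=.
- rewrite ltnn ltnNge leqnSn /= exprS.
  (* [ring] does not see the hypotheses, so the product known to be 1 is isolated first; the same
     device recurs below. *)
  rewrite [LHS](_ : _ = r ^+ m * (t * (1 - x - x * r)) +
                         x * t * r ^+ m * (1 + r)); last by ring.
  by rewrite tE; ring.
- rewrite addn1 ltnn eqxx ltnNge leqW //= gtn_eqF //= mulr0 addr0.
  rewrite [LHS](_ : _ = r ^+ c.+1 * (i * (1 - x)) + x * i * r ^+ c.+1);
    last by ring.
  by rewrite iE; ring.
rewrite addn0 leqnn ltnn eqxx /= exprS.
(* This is what the equation at [Fall c false] amounts to. Multiplying by [1 - x] and substituting
   [r] turns it into the hypothesis on [l]. *)
have lE1 : l * (1 - x) = 1 + x * i * r.
  have -> : l * (1 - x) = i * (1 - x) * (l * (1 - x)) by rewrite iE mul1r.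
  have -> : i * (1 - x) * (l * (1 - x)) =
    i * (l * ((1 - x) ^+ 2 - x ^+ 2 * y)) + i * x * (x * y * l) by ring.
  have -> : x * y * l = r - 1 by rewrite def_r; ring.
  rewrite lE -[X in _ = X + _]iE; ring.
rewrite [LHS](_ : _ = l * (1 - x) * r ^+ c + x * l * r ^+ c); last by ring.
by rewrite lE1; ring.
Qed.

(** * The pattern 201 *)

(* [Top m]: at letter m, the maximum so far.  [Below m]: at letter m, with
   maximum m.+1.  [Down m]: at letter m after a drop of height at least 2,
   from which on the word must be weakly decreasing. *)
Inductive state201 := Top of nat | Below of nat | Down of nat.

Definition cur201 s := match s with Top m => m | Below m => m | Down m => m end.

(** Drops are measured from the maximum, so from [Below m] even a step down by 1 leads to [Down]. *)
Definition next201 s a :=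
  match s with
  | Top m => Some (if (a.+1 < m)%N then Down a
                   else if a.+1 == m then Below a else Top a)
  | Below m => Some (if (a < m)%N then Down a
                     else if a == m then Below a else Top a)
  | Down m => if (a <= m)%N then Some (Down a) else None
  end.

(** In [Top] and [Below] no value fits strictly inside a drop, so 201 cannot occur. [Down m] records
    that [m.+1] lies strictly inside some drop while no value up to [m] does. *)
Definition inv201 s (u : seq nat) : Prop :=
  last 0%N u = cur201 s /\
  match s with
  | Top m => [/\ m \in u, forall z, z \in u -> (z <= m)%N &
                 forall b c, subseq [:: b; c] u -> (b <= c.+1)%N]
  | Below m => [/\ m.+1 \in u, forall z, z \in u -> (z <= m.+1)%N &
                   forall b c, subseq [:: b; c] u -> (b <= c.+1)%N]
  | Down m => [/\ avoids u [:: 2; 0; 1]%N,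
                  exists2 b, (m.+1 < b)%N & subseq [:: b; m] u &
                  forall b c z, subseq [:: b; c] u -> (z <= m)%N ->
                    ~~ (c < z < b)%N]
  end.

Lemma small_drops_avoid201 u :
  (forall b c, subseq [:: b; c] u -> (b <= c.+1)%N) -> avoids u [:: 2; 0; 1]%N.
Proof.
move=> small; apply/avoids3P => // b c d bcd; rewrite /occurs_as /=.
have /small : subseq [:: b; c] u.
  by apply: subseq_trans bcd; rewrite -/(rcons [:: b; c] d) subseq_rcons.
lia.
Qed.

Lemma inv201_avoids s u : inv201 s u -> avoids u [:: 2; 0; 1]%N.
Proof. by case: s => m [_ []] // *; apply: small_drops_avoid201. Qed.

(** The entry to [Down] from both other states, with [b] the maximum so far. Old drops have no
    interior, and new ones end at [a], so values up to [a] stay safe. *)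
Lemma inv201_Down u a b :
  (forall b c, subseq [:: b; c] u -> (b <= c.+1)%N) ->
  b \in u -> (a.+1 < b)%N -> inv201 (Down a) (rcons u a).
Proof.
move=> small b_u lt_ab; split; first by rewrite last_rcons.
split=> [| | c d z].
- apply/avoids3_rconsP => // [|c d /small]; first exact: small_drops_avoid201.
  by rewrite /occurs_as /=; lia.
- by exists b => //; rewrite subseq2_rcons eqxx b_u orbT.
by rewrite subseq2_rcons => /orP[/small | /andP[/eqP->]]; lia.
Qed.

Lemma small_drops_rcons u a :
  (forall b c, subseq [:: b; c] u -> (b <= c.+1)%N) ->
  (forall z, z \in u -> (z <= a.+1)%N) ->
  forall b c, subseq [:: b; c] (rcons u a) -> (b <= c.+1)%N.
Proof.
move=> small u_le b c.
by rewrite subseq2_rcons => /orP[/small // | /andP[/eqP-> /u_le]].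
Qed.

Lemma inv201_next s u a : inv201 s u -> (a <= (cur201 s).+1)%N ->
  if next201 s a is Some s' then inv201 s' (rcons u a)
  else ~~ avoids (rcons u a) [:: 2; 0; 1]%N.
Proof.
move=> inv_s; have av_u := inv201_avoids inv_s.
have avE := @avoids3_rconsP [:: 2; 0; 1]%N u a isT av_u.
case: s inv_s => m [_] /=.
- case=> m_u u_le small le_a; case: ltnP => [lt_a | ge_a].
    exact: inv201_Down small m_u lt_a.
  have small_a : forall b c, subseq [:: b; c] (rcons u a) -> (b <= c.+1)%N.
    by apply: small_drops_rcons small _ => z /u_le; lia.
  case: eqP => [def_m | ne_m]; (split; first by rewrite last_rcons);
    split=> // [|z]; rewrite mem_rcons inE ?eqxx //.
    by rewrite def_m m_u orbT.
  + by case/orP=> [/eqP-> // | /u_le]; lia.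
  by case/orP=> [/eqP-> // | /u_le]; lia.
- case=> m_u u_le small le_a; case: ltnP => [lt_a | ge_a].
    by apply: inv201_Down small m_u _; lia.
  have small_a : forall b c, subseq [:: b; c] (rcons u a) -> (b <= c.+1)%N.
    by apply: small_drops_rcons small _ => z /u_le; lia.
  case: eqP => [def_a | ne_a]; (split; first by rewrite last_rcons);
    split=> // [|z]; rewrite mem_rcons inE ?eqxx //.
    by rewrite def_a m_u orbT.
  + by case/orP=> [/eqP-> // | /u_le]; lia.
  by case/orP=> [/eqP-> // | /u_le]; lia.
case=> _ [b0 lt_b0 drop_u] low_u le_a; case: leqP => [a_le | a_gt].
  split; first by rewrite last_rcons.
  split=> [| | b c z].
  - by apply/avE => b c /low_u /(_ a_le).
  - exists b0; first by lia.
    rewrite subseq2_rcons eqxx.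
    by rewrite (mem_subseq drop_u) ?orbT // inE eqxx.
  rewrite subseq2_rcons => /orP[/low_u bc z_le | /andP[/eqP-> _]]; last by lia.
  by apply: bc; lia.
(* Here [a] is [m.+1], strictly between [m] and [b0]. *)
by apply/avE => /(_ _ _ drop_u); rewrite /occurs_as /=; lia.
Qed.

(** No letter lies below [Top 0], so its equation lacks the [Below] term present at every other
    [Top]; this breaks the geometric form and requires a separate value. *)
Definition phi201 (R : nzRingType) (x i r q : R) s : R :=
  match s with
  | Top 0 => i * (1 + x * q * r)
  | Top m => q * r ^+ m
  | Below m => i * (x * q * r ^+ m.+1 + r ^+ m)
  | Down m => i * r ^+ m
  end.

Lemma phi201_eq (R : comNzRingType) (x y i r q : R) :
    i * (1 - x) = 1 -> r = 1 + x * y * i ->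
    q * (1 - x - x ^+ 2 * y * i - x * r) = 1 ->
  forall s, phi201 x i r q s = 1 + x * \sum_(0 <= a < (cur201 s).+2)
              y ^+ (a < cur201 s)%N * oapp (phi201 x i r q) 0 (next201 s a).
Proof.
move=> iE def_r qE.
have geom m : x * (\sum_(0 <= a < m) y * (i * r ^+ a)) = r ^+ m - 1.
  rewrite -(geometric_sum m def_r) mulr_sumr [1 + _]addrC addrK.
  by apply: eq_bigr => a _; rewrite !mulrA.
(* [i * z] solves [w = z + x * w], the shape produced by a level step. *)
have iMx z : i * z = z + x * (i * z).
  by rewrite -{2}[z]mul1r -iE; ring.
case=> m.
- case: m => [|m].
    by rewrite 2?big_nat_recr //= big_geq //= {1}iMx; ring.
  (* From [Top m.+1] the letter [m] leads to [Below m], so it is split off, along with the level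
     step and the rise, from the geometric sum. *)
  rewrite [cur201 _]/= big_nat_recr //= big_nat_recr //= big_nat_recr //=.
  rewrite (eq_big_nat _ _ (F2 := fun a => y * (i * r ^+ a))); last first.
    by move=> a /andP[_ lt_a]; rewrite (leqW lt_a) ltnS lt_a expr1.
  rewrite !ltnS !ltnn !eqxx leqnn ltnNge leqnSn /= ltnNge leqW //= !gtn_eqF //=.
  rewrite !mulrDr geom.
  rewrite [LHS](_ : _ = r * r ^+ m *
    (q * (1 - x - x ^+ 2 * y * i - x * r)) + (x + x ^+ 2 * y * i + x * r)
     * (q * (r * r ^+ m))); last by rewrite exprS; ring.
  rewrite qE mulr1 {1}def_r !exprS; ring.
- rewrite (@sum_next_state _ _ _ _ _ Down) /=; last by move=> a /= ->.
  rewrite ltnn eqxx ltnNge leqnSn /= gtn_eqF //= [LHS]iMx !mulrDr geom; ring.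
rewrite (@sum_next_state _ _ _ _ _ Down) /=; last by move=> a /= /ltnW ->.
by rewrite leqnn ltnn /= !mulrDr geom mulr0 {1}iMx; ring.
Qed.

(** * Solving the systems and comparing with the closed form *)

Lemma unit_1subxM (f : fps2) : 1 - xvar * f \is a GRing.unit.
Proof.
apply: (unit_fps_coef0 (c := 1)); rewrite mul1r coef_fpsD coef_fps1.
by rewrite -[RHS]subr0 -(coef_var_fpsM0 f).
Qed.

(** [t] is the solution at [Rise 0], the state of the one-letter word 0. The inverses are kept as
    product relations, which suit [ring]. *)
Lemma catalan_gf102 : exists l i r t,
  [/\ i * (1 - xvar) = 1, l * ((1 - xvar) ^+ 2 - xvar ^+ 2 * yvar) = 1,
      r = 1 + xvar * yvar * l, t * (1 - xvar - xvar * r) = 1 &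
      catalan_gf [:: 1; 0; 2]%N = 1 + xvar * t].
Proof.
pose i := (1 - xvar)^-1.
pose l := ((1 - xvar) ^+ 2 - xvar ^+ 2 * yvar)^-1.
pose r := 1 + xvar * yvar * l.
pose t := (1 - xvar - xvar * r)^-1.
have iE : i * (1 - xvar) = 1.
  by rewrite mulVr // -[X in _ - X]mulr1 unit_1subxM.
have lE : l * ((1 - xvar) ^+ 2 - xvar ^+ 2 * yvar) = 1.
  rewrite mulVr //; have -> : (1 - xvar) ^+ 2 - xvar ^+ 2 * yvar =
    1 - xvar * (2 - xvar + xvar * yvar) by ring.
  exact: unit_1subxM.
have tE : t * (1 - xvar - xvar * r) = 1.
  rewrite mulVr //; have -> : 1 - xvar - xvar * r = 1 - xvar * (1 + r) by ring.
  exact: unit_1subxM.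
exists l, i, r, t; split=> //.
rewrite catalan_gf_completion; last by apply/avoids3P.
congr (1 + _ * _); rewrite -[RHS]mulr1 -(expr0 r).
apply: (completion_gf_transfer _ inv102_next (phi102_eq iE lE erefl tE)
         (s := Rise 0)) => [s u inv_s | ].
  by split; [case: inv_s | apply: inv102_avoids inv_s].
split=> //; split=> [z|b c]; first by rewrite inE leqn0.
by rewrite /=; case: ifP.
Qed.

Lemma catalan_gf201 : exists i r q,
  [/\ i * (1 - xvar) = 1, r = 1 + xvar * yvar * i,
      q * (1 - xvar - xvar ^+ 2 * yvar * i - xvar * r) = 1 &
      catalan_gf [:: 2; 0; 1]%N = 1 + xvar * (i * (1 + xvar * q * r))].
Proof.
pose i := (1 - xvar)^-1.
pose r := 1 + xvar * yvar * i.
pose q := (1 - xvar - xvar ^+ 2 * yvar * i - xvar * r)^-1.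
have iE : i * (1 - xvar) = 1.
  by rewrite mulVr // -[X in _ - X]mulr1 unit_1subxM.
have qE : q * (1 - xvar - xvar ^+ 2 * yvar * i - xvar * r) = 1.
  rewrite mulVr //; have -> : 1 - xvar - xvar ^+ 2 * yvar * i - xvar * r =
    1 - xvar * (1 + xvar * yvar * i + r) by ring.
  exact: unit_1subxM.
exists i, r, q; split=> //.
rewrite catalan_gf_completion; last by apply/avoids3P.
congr (1 + _ * _).
apply: (completion_gf_transfer _ inv201_next (phi201_eq iE erefl qE)
         (s := Top 0)) => [s u inv_s | ].
  by split; [case: inv_s | apply: inv201_avoids inv_s].
split=> //; split=> // [z|b c]; first by rewrite inE leqn0.
by rewrite /=; case: ifP.
Qed.

Theorem theorem7 (p : seq nat)
    (hp : p \in [:: [:: 1; 0; 2]%N; [:: 2; 0; 1]%N]) :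
  let x := xvar in
  let y := yvar in
  catalan_gf p =
    (1 - 3 * x + 3 * x ^+ 2 - 2 * x ^+ 2 * y - x ^+ 3 + x ^+ 3 * y) /
    ((1 - x) * (1 - 3 * x + 2 * x ^+ 2 - 2 * x ^+ 2 * y)).
Proof.
move=> x y.
have den_unit :
    (1 - x) * (1 - 3 * x + 2 * x ^+ 2 - 2 * x ^+ 2 * y) \is a GRing.unit.
  rewrite unitrM -{1}[x]mulr1 unit_1subxM /=.
  have -> : 1 - 3 * x + 2 * x ^+ 2 - 2 * x ^+ 2 * y =
            1 - x * (3 - 2 * x + 2 * x * y) by ring.
  exact: unit_1subxM.
apply: (canRL (mulrK den_unit)).
move: hp; rewrite !inE => /orP[]/eqP->.
  have [l [i [r [t [_ lE def_r tE ->]]]]] := catalan_gf102.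
  rewrite -/x -/y in lE def_r tE *.
  (* Since [r = 1 + x * y * l], the last factor is [1 - 2 * x - x ^+ 2 * y * l], and the first
     factor cancels [l]. *)
  have -> : (1 - x) * (1 - 3 * x + 2 * x ^+ 2 - 2 * x ^+ 2 * y) =
      ((1 - x) ^+ 2 - x ^+ 2 * y) * (1 - x - x * r).
    transitivity (((1 - x) ^+ 2 - x ^+ 2 * y) * (1 - 2 * x) -
      x ^+ 2 * y * (l * ((1 - x) ^+ 2 - x ^+ 2 * y))); last first.
      by rewrite def_r; ring.
    by rewrite lE; ring.
  transitivity (((1 - x) ^+ 2 - x ^+ 2 * y) * (1 - x - x * r) +
      x * ((1 - x) ^+ 2 - x ^+ 2 * y) * (t * (1 - x - x * r))); first by ring.
  transitivity (((1 - x) ^+ 2 - x ^+ 2 * y) * (1 - 2 * x) -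
      x ^+ 2 * y * (l * ((1 - x) ^+ 2 - x ^+ 2 * y)) +
      x * ((1 - x) ^+ 2 - x ^+ 2 * y)).
    by rewrite tE def_r; ring.
  by rewrite lE; ring.
have [i [r [q [iE def_r qE ->]]]] := catalan_gf201.
rewrite -/x -/y in iE def_r qE *.
set P := 1 - 3 * x + 2 * x ^+ 2 - 2 * x ^+ 2 * y.
have er : (1 - x) * r = 1 - x + x * y.
  transitivity (1 - x + x * y * (i * (1 - x))); first by rewrite def_r; ring.
  by rewrite iE mulr1.
(* [P] is the factor of [q] in [qE] cleared of denominators by [1 - x]. *)
have qP : q * P = 1 - x.
  transitivity ((1 - x) * (q * (1 - x - x ^+ 2 * y * i - x * r)));
    last by rewrite qE mulr1.
  transitivity (q * ((1 - x) * (1 - x) - x ^+ 2 * y * (i * (1 - x))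
      - x * ((1 - x) * r))); last by ring.
  by rewrite er iE /P; ring.
transitivity ((1 - x) * P + x * (i * (1 - x)) * (P + x * (q * P) * r)).
  by ring.
transitivity ((1 - x) * P + x * (P + x * ((1 - x) * r))).
  by rewrite iE qP; ring.
by rewrite er /P; ring.
Qed.
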